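(* For all integers $n\ge 1$, the even indexed Bernoulli numbers satisfy $$B_{2n}\left(2^{2n}-1\right)3^{2n-1}=\frac{2^{2n}-1}{2}+\sum_{i=1}^{n-1}\binom{2n}{2i-1}\frac{B_{2i}}{2i}\left(1-2^{2i}\right)3^{2i-1}\left(2^{2n-2i+1}-1\right),$$ and $$\left(1-2^{2n}\right)\left(1-3^{2n-1}\right)\frac{B_{2n}}{2n}=\frac{2^{2n-1}-1}{2}+\sum_{i=1}^{n-1}\binom{2n-1}{2i-1}\frac{B_{2i}}{2i}\,3^{2i-1}\left(1-2^{2i}\right)\left(2^{2n-2i}-1\right).$$
   Context: $B_n$ is the $n$-th Bernoulli number, defined by $\frac{t}{e^t-1}=\sum_{n\ge0}B_n\frac{t^n}{n!}$. *)

(* Defs.v *)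
From Stdlib Require Import Reals Arith Factorial Lra Lia.
From Coquelicot Require Import Coquelicot.
Open Scope R_scope.

(** [B] is the sequence of Bernoulli numbers: its exponential generating series
    converges to [t / (e^t - 1)] near 0.  The point [t = 0], where the closed form
    is only a removable singularity, is excluded; the values of the series at
    [t <> 0] determine all coefficients, including [B 0]. *)
Definition is_bernoulli (B : nat -> R) : Prop :=
  exists r : R, 0 < r /\
    forall t : R, 0 < Rabs t < r ->
      is_pseries (fun n => B n / INR (fact n)) t (t / (exp t - 1)).

(** Coefficients [B k / k!], obtained by solving
    [(sum_k b_k t^k) (sum_k t^k / (k+1)!) = 1] recursively. *)

Fixpoint gen_coef_upto (n : nat) : nat -> R :=
  match n with
  | O => fun k => match k with O => 1 | S _ => 0 end
  | S m => fun k =>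
      if Nat.eqb k (S m)
      then - sum_f_R0 (fun j => gen_coef_upto m j * / INR (fact (S (S m - j)))) m
      else gen_coef_upto m k
  end.

Definition gen_coef (n : nat) : R := gen_coef_upto n n.

Lemma gen_coef_upto_eq (n k : nat) : (k <= n)%nat -> gen_coef_upto n k = gen_coef k.
Proof.
induction n as [|n IH]; intros H.
- now replace k with 0%nat by lia.
- destruct (Nat.eq_dec k (S n)) as [->|Hk]; [reflexivity|].
  simpl; rewrite (proj2 (Nat.eqb_neq k (S n)) Hk); apply IH; lia.
Qed.

Lemma gen_coef_S (n : nat) :
  gen_coef (S n) = - sum_f_R0 (fun j => gen_coef j * / INR (fact (S (S n - j)))) n.
Proof.
unfold gen_coef at 1.
change (gen_coef_upto (S n) (S n)) with
  (if Nat.eqb (S n) (S n)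
   then - sum_f_R0 (fun j => gen_coef_upto n j * / INR (fact (S (S n - j)))) n
   else gen_coef_upto n (S n)).
rewrite Nat.eqb_refl; f_equal; apply sum_eq; intros j Hj.
now rewrite gen_coef_upto_eq.
Qed.

Lemma inv_fact_le_half_pow (n : nat) : 0 < / INR (fact (S n)) <= (1 / 2) ^ n.
Proof.
split; [apply Rinv_0_lt_compat, INR_fact_lt_0|].
induction n as [|n IH]; [simpl; lra|].
replace (fact (S (S n))) with (S (S n) * fact (S n))%nat by reflexivity.
rewrite mult_INR, Rinv_mult; simpl pow.
apply Rmult_le_compat; trivial.
- left; apply Rinv_0_lt_compat, lt_0_INR; lia.
- left; apply Rinv_0_lt_compat, INR_fact_lt_0.
- replace (1 / 2) with (/ 2) by lra.
  apply Rinv_le_contravar; [lra|].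
  change 2 with (INR 2); apply le_INR; lia.
Qed.

Lemma sum_half_pow (n : nat) :
  sum_f_R0 (fun j => (1 / 2) ^ (S n - j)) n = 1 - (1 / 2) ^ S n.
Proof.
induction n as [|n IH]; [simpl; lra|].
rewrite tech5.
rewrite (sum_eq _ (fun j => (1 / 2) ^ (S n - j) * (1 / 2))).
- rewrite <- scal_sum, IH.
  replace (S (S n) - S n)%nat with 1%nat by lia; simpl; lra.
- intros j Hj; replace (S (S n) - j)%nat with (S (S n - j)) by lia.
  simpl pow; ring.
Qed.

Lemma gen_coef_bound (n : nat) : Rabs (gen_coef n) <= 1.
Proof.
induction n as [n IH] using lt_wf_ind.
destruct n as [|n]; [unfold gen_coef; simpl; rewrite Rabs_R1; lra|].
rewrite gen_coef_S, Rabs_Ropp.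
eapply Rle_trans; [apply Rsum_abs|].
apply Rle_trans with (sum_f_R0 (fun j => (1 / 2) ^ (S n - j)) n).
- apply sum_Rle; intros j Hj.
  rewrite Rabs_mult, <- (Rmult_1_l ((1 / 2) ^ _)).
  destruct (inv_fact_le_half_pow (S n - j)) as [H0 H1].
  apply Rmult_le_compat; try apply Rabs_pos; [apply IH; lia|].
  now rewrite Rabs_pos_eq; [|left].
- rewrite sum_half_pow.
  assert (0 < (1 / 2) ^ S n) by (apply pow_lt; lra); lra.
Qed.

Lemma CV_radius_ge1 (a : nat -> R) (x : R) :
  (forall n, Rabs (a n) <= 1) -> Rabs x < 1 -> Rbar_lt (Rabs x) (CV_radius a).
Proof.
intros Ha Hx.
apply Rbar_lt_le_trans with 1; [exact Hx|].
apply (proj1 (CV_radius_bounded a)).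
exists 1; intros n; now rewrite pow1, Rmult_1_r.
Qed.

Lemma gen_coef_mult (n : nat) :
  PS_mult gen_coef (PS_decr_1 (fun k => / INR (fact k))) n =
  match n with O => 1 | S _ => 0 end.
Proof.
unfold PS_mult, PS_decr_1; destruct n as [|n].
- unfold gen_coef; simpl; lra.
- rewrite tech5, gen_coef_S, Nat.sub_diag.
  change (INR (fact 1)) with 1; lra.
Qed.

Lemma is_bernoulli_exists : exists B : nat -> R, is_bernoulli B.
Proof.
exists (fun n => gen_coef n * INR (fact n)); exists 1; split; [lra|].
intros t [Ht0 Ht1].
assert (Ht : t <> 0) by (intros ->; rewrite Rabs_R0 in Ht0; lra).
apply is_pseries_ext with gen_coef.
{ intros n; simpl; unfold Rdiv.
  rewrite Rmult_assoc, Rinv_r, Rmult_1_r; [reflexivity|apply INR_fact_neq_0]. }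
assert (Rb := CV_radius_ge1 gen_coef t gen_coef_bound Ht1).
assert (Re : Rbar_lt (Rabs t) (CV_radius (PS_decr_1 (fun k => / INR (fact k))))).
{ apply CV_radius_ge1; trivial; intros n; unfold PS_decr_1.
  destruct (inv_fact_le_half_pow n) as [H0 H1].
  rewrite Rabs_pos_eq; [|now left].
  apply Rle_trans with (1 := H1); apply Rle_trans with (1 ^ n);
    [apply pow_incr; lra | rewrite pow1; lra]. }
assert (Hb : is_pseries gen_coef t (PSeries gen_coef t)).
{ apply PSeries_correct, CV_radius_inside, Rb. }
assert (He : is_pseries (PS_decr_1 (fun k => / INR (fact k))) t ((exp t - 1) / t)).
{ replace ((exp t - 1) / t)
    with (scal (/ t) (plus (exp t) (opp (/ INR (fact 0))))).
  - apply (is_pseries_decr_1 (fun k => / INR (fact k)) t (/ t) (exp t));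
      [apply Rinv_l, Ht | apply is_exp_Reals].
  - unfold scal, plus, opp; simpl; unfold mult; simpl; field; exact Ht. }
assert (Hm := is_pseries_mult _ _ _ _ _ Hb He Rb Re).
apply is_pseries_unique in Hm.
rewrite (PSeries_ext _ _ t gen_coef_mult) in Hm.
assert (H1 : PSeries (fun n => match n with O => 1 | S _ => 0 end) t = 1).
{ apply is_pseries_unique.
  apply is_pseries_R.
  apply (is_lim_seq_ext (fun _ => 1) _ 1); [|apply is_lim_seq_const].
  intros n; induction n as [|n IH]; [now rewrite sum_O; simpl; ring|].
  rewrite sum_Sn, <- IH; unfold plus; simpl; ring. }
rewrite H1 in Hm.
replace (t / (exp t - 1)) with (PSeries gen_coef t); [exact Hb|].
assert (exp t - 1 <> 0).
{ intros E; rewrite E in Hm; unfold Rdiv in Hm; rewrite Rmult_0_l in Hm; lra. }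
apply Rmult_eq_reg_r with ((exp t - 1) / t).
- rewrite <- Hm; field; now split.
- intros E; rewrite E in Hm; lra.
Qed.

(* Main.v *)
Require Import Defs.
From Stdlib Require Import Reals Factorial Lra Lia.
From Coquelicot Require Import Coquelicot.
Open Scope R_scope.

(** Put [g_m = (1 - 2^(m+1)) B_(m+1) / (m+1)].  Subtracting from the Bernoulli
    series in [x] the one in [2x] and dividing by [x] shows that [g] has
    exponential generating function
    [1/(e^x - 1) - 2/(e^(2x) - 1) = 1/(e^x + 1) =: G x] ([is_egf_genocchi]).

    With [y = e^x], the factorisation [y^3 + 1 = (y + 1) (y^2 - y + 1)] gives
    [(y^2 - y) / (y^3 + 1) = 1 / (y + 1) - 1 / (y^3 + 1)], that is,
    [(e^(2x) - e^x) G(3x) = G x - G(3x)].  Comparing coefficients of [x^N / N!],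
    [sum_m C(N,m) 3^m g_m (2^(N-m) - 1) = (1 - 3^N) g_N]
    ([genocchi_convolution]).

    Finally [G x + G(-x) = 1], so [g_0 = 1/2] and [g_m = 0] for even [m > 0]:
    only [m = 0] and the odd [m = 2i - 1] survive in the sum.  For [N = 2n - 1]
    the term [i = n] has the factor [2^0 - 1 = 0], which leaves the second
    identity.  For [N = 2n] the right-hand side vanishes, and the term [i = n]
    is the opposite of [B_(2n) (2^(2n) - 1) 3^(2n-1)], which gives the first. *)

(** * Exponential generating functions near 0 *)

(** The point [0] is left out so that closed forms with a removable
    singularity there, such as [t / (exp t - 1)], are allowed. *)
Definition is_egf (a : nat -> R) (f : R -> R) : Prop :=
  locally' 0 (fun t => is_pseries (fun n => a n / INR (fact n)) t (f t)).

Lemma locally'_0_iff (P : R -> Prop) :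
  locally' 0 P <-> exists r : R, 0 < r /\ forall t, 0 < Rabs t < r -> P t.
Proof.
split.
- intros [r Hr]; exists r; split; [apply cond_pos|].
  intros t [Ht0 Htr]; apply Hr.
  + change (Rabs (t - 0) < r); now rewrite Rminus_0_r.
  + intros ->; rewrite Rabs_R0 in Ht0; lra.
- intros [r [Hr H]]; exists (mkposreal r Hr); intros t Ht Ht0; apply H.
  change (Rabs (t - 0) < r) in Ht; rewrite Rminus_0_r in Ht.
  split; [now apply Rabs_pos_lt | exact Ht].
Qed.

Lemma locally'_0_scale (P : R -> Prop) (c : R) :
  c <> 0 -> locally' 0 P -> locally' 0 (fun t => P (c * t)).
Proof.
intros Hc H; apply locally'_0_iff in H; destruct H as [r [Hr H]].
assert (Hc' := Rabs_pos_lt c Hc).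
apply locally'_0_iff; exists (r / Rabs c); split; [now apply Rdiv_lt_0_compat|].
intros t [Ht0 Htr]; apply H; rewrite Rabs_mult; split.
- now apply Rmult_lt_0_compat.
- apply Rlt_div_r in Htr; [lra | exact Hc'].
Qed.

Lemma locally'_0_neq : locally' 0 (fun t : R => t <> 0).
Proof. exists (mkposreal 1 Rlt_0_1); auto. Qed.

Lemma is_pseries_radius (a : nat -> R) (x l : R) :
  is_pseries a x l -> Rbar_le (Rabs x) (CV_radius a).
Proof.
intros H; apply Rbar_not_lt_le; intros Hlt.
apply (CV_disk_outside _ _ Hlt), ex_series_lim_0.
exists l; now apply is_pseries_R.
Qed.

Lemma is_egf_radius (a : nat -> R) (f : R -> R) :
  is_egf a f ->
  exists r : R, 0 < r /\
    Rbar_le r (CV_radius (fun n => a n / INR (fact n))).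
Proof.
intros H; apply locally'_0_iff in H; destruct H as [r [Hr H]].
exists (r / 2); split; [lra|].
assert (Hr2 : Rabs (r / 2) = r / 2) by (apply Rabs_pos_eq; lra).
rewrite <- Hr2; apply is_pseries_radius with (f (r / 2)), H; lra.
Qed.

(** The Cauchy product of two series rests on absolute convergence, which holds
    strictly inside the disks of convergence. *)
Lemma is_egf_inside (a : nat -> R) (f : R -> R) :
  is_egf a f ->
  locally' 0 (fun t => Rbar_lt (Rabs t) (CV_radius (fun n => a n / INR (fact n)))).
Proof.
intros H; destruct (is_egf_radius a f H) as [r [Hr HR]].
apply locally'_0_iff; exists r; split; [exact Hr|]; intros t Ht.
now apply Rbar_lt_le_trans with (2 := HR).
Qed.

Lemma is_egf_ext (a b : nat -> R) (f g : R -> R) :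
  (forall n, a n = b n) -> (forall t, t <> 0 -> f t = g t) ->
  is_egf a f -> is_egf b g.
Proof.
intros Hab Hfg H.
generalize (filter_and (F := locally' 0) _ _ locally'_0_neq H).
apply (filter_imp (F := locally' 0)).
intros t [Ht0 Ht]; rewrite <- Hfg by exact Ht0.
apply is_pseries_ext with (2 := Ht); intros n; now rewrite Hab.
Qed.

Lemma is_egf_minus (a b : nat -> R) (f g : R -> R) :
  is_egf a f -> is_egf b g ->
  is_egf (fun n => a n - b n) (fun t => f t - g t).
Proof.
intros Ha Hb; generalize (filter_and (F := locally' 0) _ _ Ha Hb).
apply (filter_imp (F := locally' 0)).
intros t [Hta Htb].
apply is_pseries_ext with (2 := is_pseries_minus _ _ _ _ _ Hta Htb).
intros n.
change (a n / INR (fact n) - b n / INR (fact n) = (a n - b n) / INR (fact n)).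
unfold Rdiv; ring.
Qed.

Lemma is_pseries_scale_arg (a : nat -> R) (c t l : R) :
  is_pseries (fun n => a n / INR (fact n)) (c * t) l ->
  is_pseries (fun n => c ^ n * a n / INR (fact n)) t l.
Proof.
intros H; apply is_pseries_R; apply is_pseries_R in H.
apply is_series_ext with (2 := H); intros n.
change (a n / INR (fact n) * (c * t) ^ n = c ^ n * a n / INR (fact n) * t ^ n).
rewrite Rpow_mult_distr; unfold Rdiv; ring.
Qed.

Lemma is_egf_scale (a : nat -> R) (f : R -> R) (c : R) :
  c <> 0 -> is_egf a f -> is_egf (fun n => c ^ n * a n) (fun t => f (c * t)).
Proof.
intros Hc H; apply (locally'_0_scale _ c Hc) in H.
revert H; apply (filter_imp (F := locally' 0)).
intros t; apply is_pseries_scale_arg.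
Qed.

Lemma is_egf_exp (c : R) : is_egf (fun n => c ^ n) (fun t => exp (c * t)).
Proof.
apply (filter_forall (F := locally' 0)); intros t.
apply is_pseries_ext with (fun n => c ^ n * 1 / INR (fact n)).
{ intros n; now rewrite Rmult_1_r. }
apply is_pseries_scale_arg.
apply is_pseries_ext with (2 := is_exp_Reals (c * t)).
intros n; unfold Rdiv; now rewrite Rmult_1_l.
Qed.

Lemma is_egf_mult (a b : nat -> R) (f g : R -> R) :
  is_egf a f -> is_egf b g ->
  is_egf (fun n => sum_f_R0 (fun k => Binomial.C n k * a k * b (n - k)%nat) n)
    (fun t => f t * g t).
Proof.
intros Ha Hb.
generalize (filter_and (F := locally' 0) _ _ (filter_and (F := locally' 0) _ _ Ha Hb)
  (filter_and (F := locally' 0) _ _ (is_egf_inside _ _ Ha) (is_egf_inside _ _ Hb))).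
apply (filter_imp (F := locally' 0)); intros t [[Hta Htb] [Hra Hrb]].
apply is_pseries_ext with (2 := is_pseries_mult _ _ _ _ _ Hta Htb Hra Hrb).
intros n; unfold PS_mult, Rdiv.
rewrite (Rmult_comm (sum_f_R0 _ n)), scal_sum.
apply sum_eq; intros k Hk; unfold Binomial.C; field.
repeat split; apply INR_fact_neq_0.
Qed.

(** Multiplying both series by [t] makes them agree at [t = 0] as well, after
    which uniqueness of power series coefficients applies. *)
Lemma is_egf_unique (a b : nat -> R) (f : R -> R) :
  is_egf a f -> is_egf b f -> forall n, a n = b n.
Proof.
intros Ha Hb n.
set (a' := fun k => a k / INR (fact k)); set (b' := fun k => b k / INR (fact k)).
assert (E : PS_incr_1 a' (S n) = PS_incr_1 b' (S n)).
{ apply PSeries_ext_recip.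
  - destruct (is_egf_radius _ _ Ha) as [r [Hr HR]]; rewrite CV_radius_incr_1.
    now apply Rbar_lt_le_trans with (2 := HR).
  - destruct (is_egf_radius _ _ Hb) as [r [Hr HR]]; rewrite CV_radius_incr_1.
    now apply Rbar_lt_le_trans with (2 := HR).
  - generalize (filter_and (F := locally' 0) _ _ Ha Hb).
    apply (filter_imp (F := locally 0)); intros t Ht.
    rewrite !PSeries_incr_1.
    destruct (Req_dec t 0) as [->|Ht0]; [now rewrite !Rmult_0_l|].
    destruct (Ht Ht0) as [Hta Htb]; f_equal.
    apply is_pseries_unique in Hta; apply is_pseries_unique in Htb.
    unfold a', b'; now rewrite Hta, Htb. }
simpl in E; unfold a', b' in E.
apply Rmult_eq_reg_r with (/ INR (fact n)); [exact E|].
apply Rinv_neq_0_compat, INR_fact_neq_0.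
Qed.

(** * The series of 1 / (e^x + 1) *)

(** Up to the factor [2 (m + 1)], the Genocchi number of index [m + 1]. *)
Definition genocchi (B : nat -> R) (m : nat) : R :=
  (1 - 2 ^ S m) * (B (S m) / INR (S m)).

Lemma is_egf_shift (a : nat -> R) (f : R -> R) :
  a 0%nat = 0 -> is_egf a f ->
  is_egf (fun n => a (S n) / INR (S n)) (fun t => f t / t).
Proof.
intros Ha0 H; generalize (filter_and (F := locally' 0) _ _ locally'_0_neq H).
apply (filter_imp (F := locally' 0)).
intros t [Ht0 Ht].
apply (is_pseries_decr_1 _ t (/ t)) in Ht; [|now apply Rinv_l].
replace (f t / t) with (scal (/ t) (plus (f t) (opp (a 0%nat / INR (fact 0))))).
- apply is_pseries_ext with (2 := Ht); intros n.
  change (a (S n) / INR (fact (S n)) = a (S n) / INR (S n) / INR (fact n)).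
  rewrite fact_simpl, mult_INR; field.
  split; [now apply not_0_INR | apply INR_fact_neq_0].
- rewrite Ha0; unfold scal, plus, opp; simpl; unfold mult; simpl; field; exact Ht0.
Qed.

Lemma exp_double (t : R) : exp (2 * t) = exp t * exp t.
Proof. rewrite <- exp_plus; f_equal; ring. Qed.

Lemma exp_neq_1 (t : R) : t <> 0 -> exp t - 1 <> 0.
Proof. intros Ht E; apply Ht, exp_inv; rewrite exp_0; lra. Qed.

Lemma is_egf_genocchi (B : nat -> R) :
  is_bernoulli B -> is_egf (genocchi B) (fun t => / (exp t + 1)).
Proof.
intros HB; assert (H : is_egf B (fun t => t / (exp t - 1))).
{ apply locally'_0_iff; exact HB. }
assert (H2 : 2 <> 0) by lra.
assert (Hd := is_egf_minus _ _ _ _ H (is_egf_scale _ _ 2 H2 H)).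
(* The coefficients are now [(1 - 2^k) B_k], zero at [k = 0]: divide by [t]. *)
apply is_egf_shift in Hd; [|simpl; ring].
revert Hd; apply is_egf_ext.
- intros n; unfold genocchi, Rdiv; ring.
- intros t Ht; rewrite exp_double.
  assert (H1 := exp_neq_1 t Ht); assert (Hpos := exp_pos t).
  field; repeat split; try lra.
  replace (exp t * exp t - 1) with ((exp t - 1) * (exp t + 1)) by ring.
  apply Rmult_integral_contrapositive; lra.
Qed.

(** From [1/(e^x + 1) + 1/(e^(-x) + 1) = 1]; the constant [1] is [e^(0 x)],
    with coefficients [0^m]. *)
Lemma genocchi_parity (B : nat -> R) (m : nat) :
  is_bernoulli B -> genocchi B m + (-1) ^ m * genocchi B m = 0 ^ m.
Proof.
intros HB; assert (H := is_egf_genocchi B HB).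
assert (Hm1 : -1 <> 0) by lra.
assert (E : 0 ^ m - (-1) ^ m * genocchi B m = genocchi B m); [|lra].
revert m; apply is_egf_unique with (2 := H).
generalize (is_egf_minus _ _ _ _ (is_egf_exp 0) (is_egf_scale _ _ (-1) Hm1 H)).
apply is_egf_ext; [reflexivity|]; intros t _.
replace (-1 * t) with (- t) by ring; rewrite Rmult_0_l, exp_0, exp_Ropp.
assert (Hpos := exp_pos t); field; lra.
Qed.

Lemma genocchi_0 (B : nat -> R) : is_bernoulli B -> genocchi B 0 = 1 / 2.
Proof. intros HB; generalize (genocchi_parity B 0 HB); simpl; lra. Qed.

Lemma genocchi_even (B : nat -> R) (k : nat) :
  is_bernoulli B -> (1 <= k)%nat -> genocchi B (2 * k) = 0.
Proof.
intros HB Hk; generalize (genocchi_parity B (2 * k) HB).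
rewrite pow_1_even, pow_i by lia; lra.
Qed.

Lemma genocchi_odd (B : nat -> R) (i : nat) :
  (1 <= i)%nat ->
  genocchi B (2 * i - 1) = (1 - 2 ^ (2 * i)) * (B (2 * i)%nat / INR (2 * i)).
Proof.
intros Hi; unfold genocchi; now replace (S (2 * i - 1)) with (2 * i)%nat by lia.
Qed.

(** Coefficient form of
    [(e^(2x) - e^x) / (e^(3x) + 1) = 1 / (e^x + 1) - 1 / (e^(3x) + 1)]. *)
Lemma genocchi_convolution (B : nat -> R) (N : nat) :
  is_bernoulli B ->
  sum_f_R0 (fun m => Binomial.C N m * (3 ^ m * genocchi B m) *
                     (2 ^ (N - m) - 1)) N =
  (1 - 3 ^ N) * genocchi B N.
Proof.
intros HB; assert (H := is_egf_genocchi B HB).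
assert (H3 : 3 <> 0) by lra.
assert (HG3 := is_egf_scale _ _ 3 H3 H).
assert (Hd := is_egf_minus _ _ _ _ (is_egf_exp 2) (is_egf_exp 1)).
assert (Hm := is_egf_mult _ _ _ _ HG3 Hd).
replace ((1 - 3 ^ N) * genocchi B N)
  with (genocchi B N - 3 ^ N * genocchi B N) by ring.
revert N; apply is_egf_unique with (2 := is_egf_minus _ _ _ _ H HG3).
revert Hm; apply is_egf_ext.
- intros n; apply sum_eq; intros k _; now rewrite pow1.
- intros t _; rewrite exp_double, Rmult_1_l.
  replace (3 * t) with (2 * t + t) by ring; rewrite exp_plus, exp_double.
  assert (Hpos := exp_pos t).
  assert (0 < exp t * exp t * exp t) by (repeat apply Rmult_lt_0_compat; lra).
  field; lra.
Qed.

(** * Extracting the two identities *)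

Lemma sum_last_even (f : nat -> R) (n : nat) :
  (1 <= n)%nat -> sum_f_R0 f (2 * n) = sum_f_R0 f (2 * n - 1) + f (2 * n)%nat.
Proof.
intros Hn; replace (2 * n)%nat with (S (2 * n - 1)) at 1 by lia.
rewrite tech5; do 2 f_equal; lia.
Qed.

(** The last odd index is kept apart: its term is zero in one of the two
    identities and becomes the left-hand side of the other. *)
Lemma sum_odd_part (f : nat -> R) (n : nat) :
  (1 <= n)%nat -> (forall k, (1 <= k < n)%nat -> f (2 * k)%nat = 0) ->
  sum_f_R0 f (2 * n - 1) =
  f 0%nat + sum_n_m (fun i => f (2 * i - 1)%nat) 1 (n - 1) + f (2 * n - 1)%nat.
Proof.
intros Hn; induction Hn as [|n Hn IH]; intros Hf.
- rewrite (sum_n_m_zero _ 1 (1 - 1)) by lia.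
  change (@zero R_AbelianMonoid) with 0; simpl; ring.
- replace (2 * S n - 1)%nat with (S (2 * n)) by lia.
  rewrite tech5, sum_last_even, (Hf n), IH; [|intros k Hk; apply Hf; lia|lia|lia].
  replace (S n - 1)%nat with (S (n - 1)) by lia.
  rewrite sum_n_Sm by lia.
  replace (S (n - 1)) with n by lia.
  change plus with Rplus; ring.
Qed.

Theorem corollary2 (B : nat -> R) (hB : is_bernoulli B) (n : nat) (hn : (1 <= n)%nat) :
  B (2 * n)%nat * (2 ^ (2 * n) - 1) * 3 ^ (2 * n - 1) =
    (2 ^ (2 * n) - 1) / 2 +
    sum_n_m (fun i : nat =>
      Binomial.C (2 * n) (2 * i - 1) * (B (2 * i)%nat / INR (2 * i)) *
      (1 - 2 ^ (2 * i)) * 3 ^ (2 * i - 1) * (2 ^ (2 * n - 2 * i + 1) - 1))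
      1 (n - 1)
  /\
  (1 - 2 ^ (2 * n)) * (1 - 3 ^ (2 * n - 1)) * (B (2 * n)%nat / INR (2 * n)) =
    (2 ^ (2 * n - 1) - 1) / 2 +
    sum_n_m (fun i : nat =>
      Binomial.C (2 * n - 1) (2 * i - 1) * (B (2 * i)%nat / INR (2 * i)) *
      3 ^ (2 * i - 1) * (1 - 2 ^ (2 * i)) * (2 ^ (2 * n - 2 * i) - 1))
      1 (n - 1).
Proof.
assert (HC0 : forall N, Binomial.C N 0 = 1).
{ intros N; unfold Binomial.C; rewrite Nat.sub_0_r; simpl (INR (fact 0)).
  field; apply INR_fact_neq_0. }
assert (Hterm : forall N k, (1 <= k)%nat ->
  Binomial.C N (2 * k) * (3 ^ (2 * k) * genocchi B (2 * k)) *
  (2 ^ (N - 2 * k) - 1) = 0).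
{ intros N k Hk; rewrite genocchi_even by assumption; ring. }
split.
- assert (HS := genocchi_convolution B (2 * n) hB).
  rewrite genocchi_even, Rmult_0_r in HS by assumption.
  rewrite sum_last_even, Hterm in HS by exact hn.
  rewrite sum_odd_part in HS; [|exact hn|intros k Hk; apply Hterm; lia].
  rewrite HC0, genocchi_0, Nat.sub_0_r, (genocchi_odd B n) in HS by assumption.
  replace (2 * n - (2 * n - 1))%nat with 1%nat in HS by lia.
  assert (HC : Binomial.C (2 * n) (2 * n - 1) = INR (2 * n)).
  { unfold Binomial.C; replace (2 * n - (2 * n - 1))%nat with 1%nat by lia.
    replace (2 * n)%nat with (S (2 * n - 1)) at 1 by lia.
    rewrite fact_simpl, mult_INR; replace (S (2 * n - 1)) with (2 * n)%nat by lia.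
    change (INR (fact 1)) with 1; field; apply INR_fact_neq_0. }
  rewrite HC in HS.
  rewrite (sum_n_m_ext_loc _ (fun i => Binomial.C (2 * n) (2 * i - 1) *
    (3 ^ (2 * i - 1) * genocchi B (2 * i - 1)) * (2 ^ (2 * n - (2 * i - 1)) - 1))).
  + (* The term of index [2n - 1] is the opposite of the left-hand side. *)
    assert (Hn0 : INR (2 * n) <> 0) by (apply not_0_INR; lia).
    replace (INR (2 * n) * (3 ^ (2 * n - 1) *
      ((1 - 2 ^ (2 * n)) * (B (2 * n)%nat / INR (2 * n)))) * (2 ^ 1 - 1))
      with (- (B (2 * n)%nat * (2 ^ (2 * n) - 1) * 3 ^ (2 * n - 1))) in HS
      by (field; exact Hn0).
    simpl (3 ^ 0) in HS; lra.
  + intros i Hi; rewrite genocchi_odd by lia.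
    replace (2 * n - (2 * i - 1))%nat with (2 * n - 2 * i + 1)%nat by lia.
    match goal with |- ?x = ?y => change (@eq R x y) end; ring.
- assert (HS := genocchi_convolution B (2 * n - 1) hB).
  rewrite sum_odd_part in HS; [|exact hn|intros k Hk; apply Hterm; lia].
  rewrite HC0, genocchi_0, Nat.sub_0_r, Nat.sub_diag, (genocchi_odd B n) in HS
    by assumption.
  rewrite (sum_n_m_ext_loc _ (fun i => Binomial.C (2 * n - 1) (2 * i - 1) *
    (3 ^ (2 * i - 1) * genocchi B (2 * i - 1)) *
    (2 ^ (2 * n - 1 - (2 * i - 1)) - 1))).
  + (* The term of index [2n - 1] has the factor [2 ^ 0 - 1]. *)
    simpl (3 ^ 0) in HS; simpl (2 ^ 0) in HS; lra.
  + intros i Hi; rewrite genocchi_odd by lia.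
    replace (2 * n - 1 - (2 * i - 1))%nat with (2 * n - 2 * i)%nat by lia.
    match goal with |- ?x = ?y => change (@eq R x y) end; ring.
Qed.
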